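(* Let $k$ be a field of characteristic zero and $D_2 = k_{+}\{x\}/[x^2]$. The algebra $D_2[\partial]$ of differential operators over $D_2$ is prime, i.e. for any two nonzero two-sided ideals $I,J$ of $D_2[\partial]$ one has $IJ\neq 0$.
   Context: $k\{x\}$ denotes the differential polynomial algebra in one indeterminate: the polynomial algebra $k[x_0,x_1,x_2,\dots]$ (with $x = x_0$) with the $k$-linear derivation satisfying $x_n' = x_{n+1}$. $k_{+}\{x\}$ is its subalgebra (without unity) of differential polynomials with zero constant term; $[x^2]$ is the differential ideal (ideal closed under the derivation) of $k_{+}\{x\}$ generated by $x^2$, and $D_2$ carries the induced derivation $a\mapsto a'$. For a differential algebra $A$, the algebra of differential operators $A[\partial]$ consists of finite sums $a_n\partial^n+\cdots+a_1\partial+a_0$ with $a_i\in A$, with multiplication determined by associativity and the rule $\partial a = a\partial + a'$ (so $(a\partial^i)(b\partial^j) = \sum_{l=0}^{i}\binom{i}{l} a\, b^{(l)}\partial^{i+j-l}$). *)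

(* Defs.v *)
From HB Require Import structures.
From mathcomp Require Import all_boot all_algebra.
From mathcomp Require Import monalg.

Set Implicit Arguments.
Unset Strict Implicit.
Unset Printing Implicit Defensive.

Import GRing.Theory.
Local Open Scope ring_scope.

(* k{x} = k[x_0, x_1, x_2, ...] *)
Definition dpoly (k : fieldType) := {malg k[cmonom nat]}.

Definition xvar (k : fieldType) (n : nat) : dpoly k := << ucm n >>.

Definition const_term (k : fieldType) (p : dpoly k) : k := p@_(@onecm nat).

Definition kplus (k : fieldType) (p : dpoly k) : Prop := const_term p = 0.

(* d is the k-linear derivation of k{x} with x_n' = x_(n+1) (it exists and is
   unique, so quantifying over such d is the same as fixing it) *)
Definition is_kx_derivation (k : fieldType) (d : dpoly k -> dpoly k) : Prop :=
  [/\ forall (c : k) (p q : dpoly k), d (c *: p + q) = c *: d p + d q,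
      forall p q : dpoly k, d (p * q) = d p * q + p * d q &
      forall n, d (xvar k n) = xvar k n.+1].

Record kplus_diff_ideal (k : fieldType) (d : dpoly k -> dpoly k)
    (S : dpoly k -> Prop) : Prop := {
  kdi_sub : forall p, S p -> kplus p;
  kdi_0 : S 0;
  kdi_add : forall p q, S p -> S q -> S (p + q);
  kdi_scale : forall (c : k) p, S p -> S (c *: p);
  kdi_mul : forall r p, kplus r -> S p -> S (r * p);
  kdi_der : forall p, S p -> S (d p)
}.

Definition x2ideal (k : fieldType) (d : dpoly k -> dpoly k) (p : dpoly k) : Prop :=
  forall S, kplus_diff_ideal d S -> S (xvar k 0 ^+ 2) -> S p.

(* D_2 = k_+{x}/[x^2] is handled through representatives in k_+{x}:
   two representatives p, q give the same element of D_2 iff p - q \in [x^2],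
   and the derivation of D_2 is induced by d.

   Differential operators  a_0 + a_1 \partial + ... + a_n \partial^n  are
   represented by the sequence [:: a_0; ...; a_n] of representatives
   (trailing entries may be dropped / padded with 0). *)
Definition opcoef (k : fieldType) (a : seq (dpoly k)) (i : nat) : dpoly k :=
  nth 0 a i.

Definition opadd (k : fieldType) (a b : seq (dpoly k)) : seq (dpoly k) :=
  mkseq (fun i => opcoef a i + opcoef b i) (maxn (size a) (size b)).

Definition opscale (k : fieldType) (c : k) (a : seq (dpoly k)) : seq (dpoly k) :=
  map (fun p => c *: p) a.

(* (a \partial^i)(b \partial^j) = \sum_{l <= i} C(i,l) a b^(l) \partial^(i+j-l) *)
Definition opmul (k : fieldType) (d : dpoly k -> dpoly k)
    (a b : seq (dpoly k)) : seq (dpoly k) :=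
  mkseq (fun m =>
    \sum_(i < size a) \sum_(j < size b) \sum_(l < i.+1 | (i + j - l)%N == m)
       (opcoef a i * iter l d (opcoef b j)) *+ 'C(i, l))
    (size a + size b).

Definition is_op (k : fieldType) (a : seq (dpoly k)) : Prop :=
  forall i, kplus (opcoef a i).

Definition op_eq (k : fieldType) (d : dpoly k -> dpoly k) (a b : seq (dpoly k)) : Prop :=
  forall i, x2ideal d (opcoef a i - opcoef b i).

Definition op_zero (k : fieldType) (d : dpoly k -> dpoly k) (a : seq (dpoly k)) : Prop :=
  op_eq d a [::].

(* a two-sided ideal of the k-algebra D_2[\partial], given as the (saturated)
   set of all representatives of its elements *)
Record op_ideal (k : fieldType) (d : dpoly k -> dpoly k)
    (I : seq (dpoly k) -> Prop) : Prop := {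
  oi_sub : forall a, I a -> is_op a;
  oi_sat : forall a b, I a -> is_op b -> op_eq d a b -> I b;
  oi_0 : I [::];
  oi_add : forall a b, I a -> I b -> I (opadd a b);
  oi_scale : forall (c : k) a, I a -> I (opscale c a);
  oi_mull : forall a b, is_op a -> I b -> I (opmul d a b);
  oi_mulr : forall a b, I a -> is_op b -> I (opmul d a b)
}.

Definition nonzero_ideal (k : fieldType) (d : dpoly k -> dpoly k)
    (I : seq (dpoly k) -> Prop) : Prop :=
  exists a, I a /\ ~ op_zero d a.

Definition ideal_prod (k : fieldType) (d : dpoly k -> dpoly k)
    (I J : seq (dpoly k) -> Prop) (c : seq (dpoly k)) : Prop :=
  is_op c /\
  exists s : seq (seq (dpoly k) * seq (dpoly k)),
    (forall u, u \in s -> I u.1 /\ J u.2) /\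
    op_eq d c (foldr (fun u acc => opadd (opmul d u.1 u.2) acc) [::] s).

(* Main.v *)
(** Write I for the ideal [x^2] and call a monomial spaced if its indices
    j_1 < ... < j_n satisfy j_{i+1} >= j_i + 2. The derivatives of x^2 express
    every differential polynomial modulo I through spaced monomials. Conversely,
    for polynomials f_1..f_n, g_1..g_n in one variable z, the map
      x_{j_1} ... x_{j_n} |-> sum_{p, q in S_n} sgn p sgn q
                                prod_r (f_{p r} g_{q r})^(j_r)
    into k[z] commutes with the derivations and kills I (exchanging two f's
    changes the sign).

    The key fact is that P Q^(n) is not in I for some n, unless P or Q is in I.
    Otherwise the version of the functional in which the factors of P are
    evaluated at z = 0 has all its z-derivatives at 0 equal to zero when applied
    to (P, Q), so it vanishes and may be evaluated at z = 1 in the factors of Q.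
    Choosing the f's and g's supported either at 0 or at 1, and equal there to
    powers of z and z - 1, a rearrangement inequality isolates one product of
    spaced monomials of P and Q, a contradiction.

    For operators a and b with leading coefficients A and B, the coefficients of
    (a x_w \partial^r) b depend polynomially on r. If these products all vanish,
    the L-th finite difference in r of a suitable coefficient gives
    A x_w B^(L) in I for every L, which the key fact excludes for some w. *)
From Stdlib Require Import Classical.
Require Import Defs.
From HB Require Import structures.
From mathcomp Require Import all_boot all_fingroup all_algebra.
From mathcomp Require Import monalg finmap zify ring.
Set Implicit Arguments.
Unset Strict Implicit.
Unset Printing Implicit Defensive.
Import GRing.Theory.
Local Open Scope ring_scope.

(** * Spaced monomials *)

Section Monomials.
Variables (A : comNzRingType) (x : nat -> A).
Implicit Types s t : seq nat.

Definition mon s := \prod_(j <- s) x j.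

Lemma mon_nil : mon [::] = 1.
Proof. by rewrite /mon big_nil. Qed.

Lemma mon_cons j s : mon (j :: s) = x j * mon s.
Proof. by rewrite /mon big_cons. Qed.

Lemma mon_cat s t : mon (s ++ t) = mon s * mon t.
Proof. by rewrite /mon big_cat. Qed.

Lemma mon_perm s t : perm_eq s t -> mon s = mon t.
Proof. by move=> st; rewrite /mon (perm_big _ st). Qed.

End Monomials.

(** The index sequences of the terms that the Leibniz rule gives for the derivative of [mon x s]. *)
Fixpoint succ_each (s : seq nat) : seq (seq nat) :=
  if s is x :: s' then (x.+1 :: s') :: map (cons x) (succ_each s') else [::].

Section Derivation.
Variables (k : fieldType) (A : comAlgType k) (d : A -> A).
Hypothesis der_lin : forall c p q, d (c *: p + q) = c *: d p + d q.
Hypothesis derM : forall p q, d (p * q) = d p * q + p * d q.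
Implicit Types (p q : A) (s : seq nat).

Lemma derD p q : d (p + q) = d p + d q.
Proof. by have := der_lin 1 p q; rewrite !scale1r. Qed.

Lemma der0 : d 0 = 0.
Proof. by apply: (addIr (d 0)); rewrite -derD !add0r. Qed.

Lemma derZ c p : d (c *: p) = c *: d p.
Proof. by have := der_lin c p 0; rewrite der0 !addr0. Qed.

Lemma derMn p n : d (p *+ n) = d p *+ n.
Proof. by elim: n => [|n IHn]; rewrite ?mulr0n ?der0 // !mulrS derD IHn. Qed.

Lemma der_sum (T : Type) (r : seq T) (F : T -> A) :
  d (\sum_(i <- r) F i) = \sum_(i <- r) d (F i).
Proof. exact: (big_morph d derD der0). Qed.

Lemma iter_derB n p q : iter n d (p - q) = iter n d p - iter n d q.
Proof. by elim: n => //= n ->; rewrite -!scaleN1r derD derZ. Qed.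

Lemma der1 : d 1 = 0.
Proof. by apply: (addrI (d 1)); rewrite addr0; have := derM 1 1; rewrite !mul1r mulr1. Qed.

Lemma iter_derM n p q :
  iter n d (p * q) =
  \sum_(i < n.+1) (iter i d p * iter (n - i) d q) *+ 'C(n, i).
Proof.
elim: n => [|n IHn]; first by rewrite big_ord1.
rewrite iterS IHn der_sum.
pose f i j := iter i d p * iter j d q.
have -> : \sum_(i < n.+1) d (iter i d p * iter (n - i) d q *+ 'C(n, i)) =
    \sum_(i < n.+1) f i.+1 (n - i)%N *+ 'C(n, i) +
    \sum_(i < n.+1) f i (n.+1 - i)%N *+ 'C(n, i).
  rewrite -big_split; apply: eq_bigr => i _.
  by rewrite derMn derM mulrnDl /f subSn // -ltnS ltn_ord.
have -> : \sum_(i < n.+1) f i (n.+1 - i)%N *+ 'C(n, i) =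
    \sum_(i < n.+2) f i (n.+1 - i)%N *+ 'C(n, i).
  by rewrite [RHS]big_ord_recr /= bin_small // mulr0n addr0.
rewrite [X in _ + X]big_ord_recl [RHS]big_ord_recl /= !bin0 addrCA; congr (_ + _); rewrite -big_split /=.
apply: eq_bigr => i _; rewrite /bump /= add1n subSS binS mulrnDr addrC.
by rewrite -/(f i.+1 (n - i)%N).
Qed.

Variable x : nat -> A.
Hypothesis der_x : forall n, d (x n) = x n.+1.

Lemma der_mon s : d (mon x s) = \sum_(t <- succ_each s) mon x t.
Proof.
elim: s => [|j s IHs]; first by rewrite mon_nil der1 big_nil.
rewrite /= big_cons big_map mon_cons derM der_x IHs mulr_sumr mon_cons.
by congr (_ + _); apply: eq_bigr => t _; rewrite mon_cons.
Qed.

Lemma iter_der_x n : iter n d (x 0%N) = x n.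
Proof. by elim: n => //= n ->; rewrite der_x. Qed.

End Derivation.

Definition gap2 (i j : nat) := (i.+1 < j)%N.

Definition spaced s := sorted gap2 s.

Definition sumsq s := sumn [seq (x ^ 2)%N | x <- s].

(** The bound makes [sumn s ^ 2 - sumsq s] a termination measure for a rewriting that keeps the sum
    of the indices and increases the sum of their squares. *)
Lemma sumsq_le s : (sumsq s <= sumn s ^ 2)%N.
Proof. by elim: s => //= x s; rewrite /sumsq /=; nia. Qed.

Lemma spread_sq i j t : (i < j)%N -> (0 < t)%N ->
  ((i + t) ^ 2 + j ^ 2 < i ^ 2 + (j + t) ^ 2)%N.
Proof. by rewrite !expnS !expn0 !muln1 => ij t0; nia. Qed.

Lemma perm_sumn s t : perm_eq s t -> sumn s = sumn t.
Proof. by move=> st; rewrite !sumnE (perm_big _ st). Qed.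

Lemma sorted_not_spaced s : sorted leq s -> ~~ spaced s ->
  exists a b t, [/\ perm_eq s (a :: b :: t), (a <= b)%N & (b <= a.+1)%N].
Proof.
elim: s => [|a [|b s] IHs] //= /andP[ab bs].
have [|nbs] := boolP (spaced (b :: s)).
  move=> bs2; rewrite /spaced /= in bs2 *; rewrite bs2 andbT /gap2 => ab2.
  by exists a, b, s; split=> //; lia.
have [a' [b' [t [pst ab' ba']]]] := IHs bs nbs => _.
exists a', b', (a :: t); split=> //.
apply: (@perm_trans _ (a :: a' :: b' :: t)); first by rewrite perm_cons.
by rewrite (perm_catCA [:: a] [:: a'; b'] t).
Qed.

(** * Reduction to spaced monomials by the derivatives of x^2 *)

Section Reduction.
Variables (k : fieldType) (A : comAlgType k) (d : A -> A).
Hypothesis der_lin : forall c p q, d (c *: p + q) = c *: d p + d q.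
Hypothesis derM : forall p q, d (p * q) = d p * q + p * d q.
Variable x : nat -> A.
Hypothesis der_x : forall n, d (x n) = x n.+1.
Hypothesis char0 : [pchar k] =i pred0.
Variable R : A -> Prop.
Hypothesis R0 : R 0.
Hypothesis R_lin : forall c p q, R p -> R q -> R (c *: p + q).
Hypothesis R_x2 : forall n p, R (p * iter n d (x 0%N * x 0%N)).
Hypothesis R_spaced : forall s, spaced s -> R (mon x s).

Lemma natr_neq0 n : (0 < n)%N -> n%:R != 0 :> k.
Proof. by move=> n0; have -> := (pcharf0P k).1 char0; rewrite -lt0n. Qed.

Let RZ c p : R p -> R (c *: p).
Proof. by move=> rp; rewrite -[_ *: _]addr0; apply: R_lin. Qed.

Let RD p q : R p -> R q -> R (p + q).
Proof. by rewrite -{2}[p]scale1r; apply: R_lin. Qed.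

Let R_sum (T : Type) (r : seq T) (P : pred T) (F : T -> A) :
  (forall i, P i -> R (F i)) -> R (\sum_(i <- r | P i) F i).
Proof. by move=> FP; elim/big_rec: _ => // i p Pi; apply: RD (FP i Pi). Qed.

(* The v-th derivative of x^2 rewrites x_a x_b with b - a <= 1 and a + b = v
   into products x_l x_{v-l} with larger sum of squares of the indices. *)
Lemma reduce_mon s : R (mon x s).
Proof.
have [n] := ubnP (sumn s ^ 2 - sumsq s)%N; elim: n s => // n IHn s0 ltn.
pose s := sort leq s0; have ss0 : perm_eq s s0 by rewrite perm_sort.
rewrite -(mon_perm _ ss0).
have [ns|] := boolP (spaced s); first exact: R_spaced.
move=> /(sorted_not_spaced (sort_sorted leq_total _))[a [b [t [st ab ba]]]].
rewrite (mon_perm _ st); set v := (a + b)%N.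
have {}ltn : (sumn (a :: b :: t) ^ 2 - sumsq (a :: b :: t) < n.+1)%N.
  have p0 : perm_eq s0 (a :: b :: t) by rewrite perm_sym in ss0; apply: perm_trans st.
  by rewrite /sumsq -(perm_sumn p0) -(perm_sumn (perm_map _ p0)).
pose P (l : 'I_v.+1) := (l == a :> nat) || (l == b :> nat).
pose G (l : 'I_v.+1) := mon x [:: (l : nat), (v - l)%N & t] *+ 'C(v, l).
have relR : R (\sum_l G l).
  have := R_x2 v (mon x t); rewrite iter_derM // mulr_sumr.
  congr R; apply: eq_bigr => l _; rewrite /G !mon_cons !iter_der_x // mulrnAr.
  by rewrite mulrC mulrA.
rewrite (bigID P) /= in relR.
(* The terms l = a and l = b are the same monomial (a single term if a = b), so their total
   coefficient [c] is a positive integer, invertible in characteristic zero. *)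
have GP l : P l -> G l = 'C(v, a)%:R *: mon x [:: a, b & t].
  rewrite /G scaler_nat => /orP[]/eqP ->.
    by rewrite /v addKn.
  by rewrite -bin_sub ?leq_addl // /v addnK; congr (_ *+ _); rewrite !mon_cons mulrCA.
rewrite (eq_bigr _ GP) sumr_const -scaler_nat scalerA -natrM in relR.
set c : k := (_ * _)%:R in relR.
have c0 : c != 0.
  apply: natr_neq0; rewrite muln_gt0 bin_gt0 leq_addr andbT.
  have av : (a < v.+1)%N by rewrite ltnS leq_addr.
  by apply/card_gt0P; exists (Ordinal av); rewrite unfold_in /P eqxx.
have rG : R (\sum_(l | ~~ P l) G l).
  apply: R_sum => l; rewrite negb_or => /andP[la lb].
  rewrite /G -scaler_nat; apply: RZ; apply: IHn.
  have := sumsq_le [:: (l : nat), (v - l)%N & t].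
  have hv : (v = a + b)%N by [].
  have lv : (l <= v)%N by rewrite -ltnS ltn_ord.
  rewrite /sumsq /= in ltn *.
  rewrite -/(sumsq t) ltnS !addnA in ltn *.
  (* As b <= a + 1, an index l other than a and b lies outside the interval from a to b, so the pair
     l, v - l is spread further apart. *)
  have sq : (a ^ 2 + b ^ 2 < l ^ 2 + (v - l) ^ 2)%N.
    have [e [ve le lab]] : exists e, [/\ (v - l = e)%N, (l + e = a + b)%N
        & (l < a \/ b < l)%N] by exists (v - l)%N; split=> //; lia.
    rewrite ve; case: lab => lab.
      have E1 : (l + (a - l) = a)%N by lia.
      have E2 : (b + (a - l) = e)%N by lia.
      by rewrite -E2 -{1}E1; apply: spread_sq; lia.
    have E1 : (e + (l - b) = a)%N by lia.
    have E2 : (b + (l - b) = l)%N by lia.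
    by rewrite -E2 [(_ + e ^ 2)%N]addnC -{1}E1; apply: spread_sq; lia.
  rewrite subnKC //.
  lia.
have -> : mon x [:: a, b & t] = c^-1 *: (c *: mon x [:: a, b & t]).
  by rewrite scalerA mulVf // scale1r.
apply: RZ; rewrite -[_ *: _](addrK (\sum_(l | ~~ P l) G l)).
by rewrite addrC -scaleN1r; apply: R_lin.
Qed.

End Reduction.

(** * The monomial basis of k{x} *)

Section MonomialBasis.
Variable k : fieldType.
Implicit Types (p q : dpoly k) (s : seq nat) (m : cmonom nat).

Local Notation mon := (mon (xvar k)).

Definition cmon s : cmonom nat := foldr (fun j => mmul (ucm j)) mone s.

Definition exps m : seq nat :=
  sort leq (flatten [seq nseq (m i) i | i <- finsupp m]).

Lemma monE s : mon s = << cmon s >>.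
Proof.
elim: s => [|j s IHs]; first by rewrite mon_nil.
rewrite mon_cons IHs; transitivity (fgmul (<< ucm j >> : dpoly k) << cmon s >>).
  exact: malgM_def.
etransitivity; first exact: fgmulUU.
rewrite (mulr1 (1 : k)); reflexivity.
Qed.

Lemma cmonE s i : cmon s i = count_mem i s.
Proof. by elim: s => [|j s IHs]; rewrite ?cm1 //= cmM cmU IHs. Qed.

Lemma count_exps m i : count_mem i (exps m) = m i.
Proof.
rewrite /exps (seq.permP (permEl (perm_sort _ _))) count_flatten -map_comp.
rewrite sumnE big_map.
under eq_bigr do rewrite /= count_nseq /=.
have [im|im] := boolP (i \in finsupp m).
  rewrite (big_fsetD1 i) //= eqxx mul1n big1_fset ?addn0 // => j.
  by rewrite in_fsetD1 => /andP[/negbTE -> _] _; rewrite mul0n.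
move: (im); rewrite -cmE_eq0 => /eqP ->; rewrite big1_fset // => j jm _.
by case: eqP im => [<-|]; rewrite ?jm // mul0n.
Qed.

Lemma exps_cmon s : perm_eq (exps (cmon s)) s.
Proof. by apply/allP=> i _ /=; rewrite count_exps cmonE. Qed.

Lemma cmon_exps m : cmon (exps m) = m.
Proof. by apply/eqP/cmP => i; rewrite cmonE count_exps. Qed.

Lemma exps_inj : injective exps.
Proof. by move=> m m' /(congr1 cmon); rewrite !cmon_exps. Qed.

Lemma mon_exps m : mon (exps m) = << m >>.
Proof. by rewrite monE cmon_exps. Qed.

Lemma dpolyE p : p = \sum_(m <- msupp p) p@_m *: mon (exps m).
Proof.
rewrite [LHS]monalgE; apply: eq_bigr => m _; rewrite mon_exps.
move: (p@_m) => c; apply/malgP => m'; rewrite mcoeffZ.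
etransitivity; first exact: mcoeffU.
rewrite -mulr_natr; congr (c * _); symmetry; exact: mcoeffU.
Qed.

Lemma dpoly_ind (P : dpoly k -> Prop) :
  P 0 -> (forall c p q, P p -> P q -> P (c *: p + q)) -> (forall s, P (mon s)) ->
  forall p, P p.
Proof.
move=> P0 PD Pm p; rewrite [p]dpolyE; elim/big_rec: _ => // m q _; exact: PD.
Qed.

(** The linear map sending [mon s] to [F s], provided [F] is symmetric: [exps] always picks the
    sorted index sequence. *)
Definition linext (F : seq nat -> {poly k}) p : {poly k} :=
  mmap polyC (fun m => F (exps m)) p.

Lemma linextE F p : linext F p = \sum_(m <- msupp p) p@_m *: F (exps m).
Proof. by apply: eq_bigr => m _; rewrite mul_polyC. Qed.

Lemma linext_lin F c p q : linext F (c *: p + q) = c *: linext F p + linext F q.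
Proof.
rewrite /linext mmapD; congr (_ + _).
rewrite (mmapEw (msuppZ_le c p)) mmapE scaler_sumr; apply: eq_bigr => m _.
by rewrite mcoeffZ /= polyCM -mulrA mul_polyC.
Qed.

Lemma linext0 F : linext F 0 = 0.
Proof. exact: mmap0. Qed.

Lemma linext_mon F s :
  (forall s t, perm_eq s t -> F s = F t) -> linext F (mon s) = F s.
Proof.
move=> symF; rewrite monE; transitivity ((1 : k)%:P * F (exps (cmon s))).
  exact: mmapU.
by rewrite polyC1 mul1r; apply: symF; apply: exps_cmon.
Qed.

End MonomialBasis.

(** * The differential ideal generated by x^2 *)

Section ConstTerm.
Variable k : fieldType.
Implicit Types p q : dpoly k.

Lemma const_termD p q : const_term (p + q) = const_term p + const_term q.
Proof. exact: mcoeffD. Qed.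

Lemma const_termZ c p : const_term (c *: p) = c * const_term p.
Proof. exact: mcoeffZ. Qed.

Lemma const_termM p q : const_term (p * q) = const_term p * const_term q.
Proof. exact: (mcoeff1g_is_multiplicative _ _).1. Qed.

Lemma const_term1 : const_term (1 : dpoly k) = 1.
Proof. exact: (mcoeff1g_is_multiplicative _ _).2. Qed.

Lemma const_term_xvar n : const_term (xvar k n) = 0.
Proof.
have cf : const_term (xvar k n) = (ucm n == mone)%:R by exact: mcoeffU1.
by rewrite cf cm1_eq1.
Qed.

Lemma kplus_mull p q : kplus q -> kplus (p * q).
Proof. by move=> q0; rewrite /kplus const_termM q0 mulr0. Qed.

Lemma kplus_mulr p q : kplus p -> kplus (p * q).
Proof. by rewrite mulrC; apply: kplus_mull. Qed.

Lemma kplusD p q : kplus p -> kplus q -> kplus (p + q).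
Proof. by rewrite /kplus const_termD => -> ->; rewrite addr0. Qed.

Lemma kplusZ c p : kplus p -> kplus (c *: p).
Proof. by rewrite /kplus const_termZ => ->; rewrite mulr0. Qed.

Lemma kplus0 : kplus (0 : dpoly k).
Proof. exact: mcoeff0. Qed.

Lemma kplus_sum (T : Type) (r : seq T) (P : pred T) (F : T -> dpoly k) :
  (forall i, P i -> kplus (F i)) -> kplus (\sum_(i <- r | P i) F i).
Proof. by move=> FP; elim/big_rec: _ => [|i p Pi]; [exact: kplus0 | apply: kplusD (FP i Pi)]. Qed.

End ConstTerm.

(** * Normal forms modulo [x^2] *)

Section NormalForm.
Variables (k : fieldType) (d : dpoly k -> dpoly k).
Hypothesis d_der : is_kx_derivation d.
Implicit Types (p q : dpoly k) (s : seq nat).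
Local Notation mon := (mon (xvar k)).
Local Notation I := (x2ideal d).

Let d_lin : forall (c : k) (p q : dpoly k), d (c *: p + q) = c *: d p + d q.
Proof. by case: d_der. Qed.

Let dM : forall p q : dpoly k, d (p * q) = d p * q + p * d q.
Proof. by case: d_der. Qed.

Let d_x : forall n, d (xvar k n) = xvar k n.+1.
Proof. by case: d_der. Qed.

Lemma kplus_der p : kplus (d p).
Proof.
elim/dpoly_ind: p => [|c p q p0 q0|s].
- by rewrite (der0 d_lin); exact: kplus0.
- by rewrite d_lin; apply: kplusD => //; apply: kplusZ.
rewrite (der_mon dM d_x) big_seq; apply: kplus_sum => -[|j t].
  by case: s => [|x s] //=; rewrite inE => /mapP[].
by rewrite mon_cons => _; apply: kplus_mulr; exact: const_term_xvar.
Qed.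

Lemma x2ideal_diff_ideal : kplus_diff_ideal d I.
Proof.
split=> [p Ip||p q Ip Iq|c p Ip|r p r0 Ip|p Ip].
(* The set [kplus] is itself a differential ideal containing x^2, hence contains I. *)
- apply: Ip; last by apply: kplus_mulr; exact: const_term_xvar.
  split=> //; [exact: kplus0|exact: kplusD|exact: kplusZ| |].
    by move=> r q _; exact: kplus_mull.
  by move=> q _; exact: kplus_der.
- by move=> S [].
- by move=> S SI Sx; apply: (kdi_add SI); [apply: Ip|apply: Iq].
- by move=> S SI Sx; apply: (kdi_scale SI); apply: Ip.
- by move=> S SI Sx; apply: (kdi_mul SI) => //; apply: Ip.
- by move=> S SI Sx; apply: (kdi_der SI); apply: Ip.
Qed.

Lemma x2ideal_x2 : I (xvar k 0 ^+ 2).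
Proof. by []. Qed.

Lemma x2ideal0 : I 0.
Proof. exact: kdi_0 x2ideal_diff_ideal. Qed.

Lemma x2idealD p q : I p -> I q -> I (p + q).
Proof. exact: kdi_add x2ideal_diff_ideal p q. Qed.

Lemma x2idealZ c p : I p -> I (c *: p).
Proof. exact: kdi_scale x2ideal_diff_ideal c p. Qed.

Lemma x2idealN p : I p -> I (- p).
Proof. by rewrite -scaleN1r; apply: x2idealZ. Qed.

Lemma x2idealB p q : I p -> I q -> I (p - q).
Proof. by move=> Ip Iq; apply: x2idealD => //; apply: x2idealN. Qed.

Lemma x2ideal_der n p : I p -> I (iter n d p).
Proof. by move=> Ip; elim: n => //= n; apply: kdi_der x2ideal_diff_ideal _. Qed.

(** [kdi_mul] admits only multipliers in k_+; the constant term of [r] is split off and acts as a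
    scalar. *)
Lemma x2idealM r p : I p -> I (r * p).
Proof.
move=> Ip; set c := const_term r.
have -> : r * p = c *: p + (r - c *: 1) * p.
  by rewrite mulrBl -scalerAl mul1r addrC subrK.
apply: x2idealD; first exact: x2idealZ.
apply: (kdi_mul x2ideal_diff_ideal) => //.
by rewrite /kplus -scaleN1r const_termD !const_termZ const_term1 mulr1 mulN1r subrr.
Qed.

Lemma x2idealMr r p : I p -> I (p * r).
Proof. by rewrite mulrC; apply: x2idealM. Qed.

Lemma x2idealMn p n : I p -> I (p *+ n).
Proof.
move=> Ip; elim: n => [|n IHn]; first exact: x2ideal0.
by rewrite mulrS; apply: x2idealD.
Qed.

Lemma x2ideal_sum (T : Type) (r : seq T) (P : pred T) (F : T -> dpoly k) :
  (forall i, P i -> I (F i)) -> I (\sum_(i <- r | P i) F i).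
Proof.
by move=> FP; elim/big_rec: _ => [|i p Pi]; [exact: x2ideal0|apply: x2idealD (FP i Pi)].
Qed.

Definition spaced_poly p := forall m, m \in msupp p -> spaced (exps m).

Definition reducible p := exists2 q, I (p - q) & spaced_poly q.

Lemma spaced_poly_lin c p q :
  spaced_poly p -> spaced_poly q -> spaced_poly (c *: p + q).
Proof.
move=> np nq m /(fsubsetP (msuppD_le _ _)); rewrite in_fsetU => /orP[|]; last exact: nq.
by move=> /(fsubsetP (msuppZ_le _ _)); exact: np.
Qed.

Lemma exps_cmon_spaced s : spaced s -> exps (cmon s) = s.
Proof.
move=> ns; apply: (sorted_eq leq_trans anti_leq); last exact: exps_cmon.
  exact/sort_sorted/leq_total.
by apply: sub_sorted ns => i j; rewrite /gap2; lia.
Qed.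

Lemma spaced_poly_mon s : spaced s -> spaced_poly (mon s).
Proof.
move=> ns m; rewrite monE => /(fsubsetP msuppU_le); rewrite in_fset1 => /eqP ->.
by rewrite exps_cmon_spaced.
Qed.

Lemma reducible_lin c p q : reducible p -> reducible q -> reducible (c *: p + q).
Proof.
move=> [p' Ip np] [q' Iq nq]; exists (c *: p' + q'); last exact: spaced_poly_lin.
have -> : c *: p + q - (c *: p' + q') = c *: (p - p') + (q - q').
  by rewrite scalerBr opprD addrACA.
by apply: x2idealD => //; apply: x2idealZ.
Qed.

Lemma reducible_x2ideal p : I p -> reducible p.
Proof. by exists 0; rewrite ?subr0 // => m; rewrite msupp0. Qed.

Hypothesis char0 : [pchar k] =i pred0.

Lemma normal_form p : reducible p.
Proof.
elim/dpoly_ind: p => [|c p q|s]; first by apply: reducible_x2ideal; apply: x2ideal0.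
  exact: reducible_lin.
apply: (reduce_mon d_lin dM d_x char0) => [|c p q|n p|t nt].
- by apply: reducible_x2ideal; apply: x2ideal0.
- exact: reducible_lin.
- by apply: reducible_x2ideal; apply: x2idealM; apply: x2ideal_der; exact: x2ideal_x2.
by exists (mon t); [rewrite subrr; exact: x2ideal0|exact: spaced_poly_mon].
Qed.

End NormalForm.

(** * Alternating functionals *)

(** The Leibniz rule for tagged sequences: an entry tagged [true] stands for a constant and is never
    raised. *)
Fixpoint succ_mobile (s : seq (bool * nat)) : seq (seq (bool * nat)) :=
  if s is (b, j) :: s' then
    (if b then [::] else [:: (b, j.+1) :: s']) ++ map (cons (b, j)) (succ_mobile s')
  else [::].

Lemma size_succ_mobile s t : t \in succ_mobile s -> size t = size s.
Proof.
elim: s t => [|[b j] s IHs] t //=; rewrite mem_cat => /orP[|/mapP[t' ts ->]].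
  by case: b => //; rewrite inE => /eqP ->.
by rewrite /= (IHs _ ts).
Qed.

Definition mobile : seq nat -> seq (bool * nat) := map (pair false).
Definition frozen : seq nat -> seq (bool * nat) := map (pair true).

Lemma succ_mobile_cat s t :
  succ_mobile (frozen s ++ mobile t) = [seq frozen s ++ mobile u | u <- succ_each t].
Proof.
elim: s => [|j s IHs] /=; last by rewrite IHs -map_comp.
by elim: t => [|j t IHt] //=; rewrite IHt -!map_comp.
Qed.

Section Alternating.
Variables (k : fieldType) (N : nat) (f g : 'I_N -> {poly k}).
Implicit Types (s t : seq (bool * nat)) (p q : 'S_N).

(* A [true] tag evaluates the derivative at [0], a [false] tag leaves it as a
   polynomial, so that only the [false] slots are seen by differentiation. *)
Definition jet (bj : bool * nat) (h : {poly k}) : {poly k} :=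
  if bj.1 then (h^`(bj.2)).[0]%:P else h^`(bj.2).

Definition altterm p q s :=
  \prod_(r < N) jet (nth (false, 0%N) s r) (f (p r) * g (q r)).

Definition altsum s : {poly k} :=
  if size s == N then
    \sum_(p : 'S_N) \sum_(q : 'S_N) (-1) ^+ p * (-1) ^+ q * altterm p q s
  else 0.

(** Permuting the slots by [u] is absorbed by reindexing both p and q with [u]; its sign then occurs
    twice and cancels. This symmetry makes the functional well defined on commutative monomials. *)
Lemma altsum_perm s t : perm_eq s t -> altsum s = altsum t.
Proof.
move=> st; rewrite /altsum (perm_size st); case: eqP => // /eqP szt.
have /tuple_permP[u su] : perm_eq s (Tuple szt) by [].
have nth_s (r : 'I_N) : nth (false, 0%N) s r = nth (false, 0%N) t (u r).
  by rewrite su -tnth_nth tnth_mktuple (tnth_nth (false, 0%N)).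
have term_u p q : altterm (u * p) (u * q) s = altterm p q t.
  rewrite /altterm [RHS](reindex_perm u) /=; apply: eq_bigr => r _.
  by rewrite nth_s !permM.
rewrite (reindex_inj (mulgI u)); apply: eq_bigr => p _.
rewrite (reindex_inj (mulgI u)); apply: eq_bigr => q _.
rewrite term_u; congr (_ * _).
rewrite !odd_permM; move: (odd_perm u) (odd_perm p) (odd_perm q) => b c e.
by rewrite !signr_addb mulrACA -expr2 sqrr_sign mul1r.
Qed.

End Alternating.

Lemma deriv_prod_jet (k : fieldType) N (h : 'I_N -> {poly k}) s : size s = N ->
  (\prod_(r < N) jet (nth (false, 0%N) s r) (h r))^`() =
  \sum_(t <- succ_mobile s) \prod_(r < N) jet (nth (false, 0%N) t r) (h r).
Proof.
elim: N h s => [|N IHN] h [|[b j] s] //=.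
  by rewrite !big_ord0 -polyC1 derivC big_nil.
move=> [szs]; rewrite big_ord_recl /= derivM IHN // big_cat big_map /=.
rewrite mulr_sumr; congr (_ + _); last first.
  by apply: eq_bigr => t _; rewrite big_ord_recl.
case: b => /=; first by rewrite derivC mul0r big_nil.
by rewrite big_seq1 big_ord_recl /= -derivnS.
Qed.

(** * The functional on k{x}, its compatibility with derivations and its vanishing on [x^2] *)

Section Functional.
Variables (k : fieldType) (d : dpoly k -> dpoly k).
Hypothesis d_der : is_kx_derivation d.
Hypothesis char0 : [pchar k] =i pred0.
Local Notation mon := (mon (xvar k)).
Variables (N : nat) (f g : 'I_N -> {poly k}).
Local Notation alt := (altsum f g).
Implicit Types (p q : dpoly k) (s t : seq (bool * nat)).

Lemma deriv_altsum s : (alt s)^`() = \sum_(t <- succ_mobile s) alt t.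
Proof.
rewrite /altsum; case: eqP => szs; last first.
  rewrite derivC big_seq big1 // => t /size_succ_mobile ->.
  by case: eqP szs.
rewrite [RHS](eq_big_seq (fun t =>
  \sum_(p : 'S_N) \sum_(q : 'S_N) (-1) ^+ p * (-1) ^+ q * altterm f g p q t)); last first.
  by move=> t /size_succ_mobile ->; rewrite szs eqxx.
have signD (b : bool) (h : {poly k}) : ((-1) ^+ b * h)^`() = (-1) ^+ b * h^`().
  by rewrite !mulr_sign; case: b; rewrite ?derivN.
rewrite raddf_sum exchange_big; apply: eq_bigr => p _.
rewrite raddf_sum exchange_big; apply: eq_bigr => q _ /=.
by rewrite -mulrA !signD deriv_prod_jet // mulrA mulr_sumr.
Qed.

(** For fixed q, composing p with the transposition of the first two slots keeps the product, as
    nothing is differentiated there, and changes the sign. The sum is its own negative, and 2 is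
    invertible. *)
Lemma altsum_x2 s : alt [:: (false, 0%N), (false, 0%N) & s] = 0.
Proof.
rewrite /altsum; case: eqP => //= szs; rewrite exchange_big big1 //= => q _.
have N1 : (1 < N)%N by rewrite -szs.
pose i0 := Ordinal (ltnW N1); pose i1 := Ordinal N1.
set S := LHS.
have SN : S = - S.
  rewrite {1}/S (reindex_inj (mulgI (tperm i0 i1))) /= -sumrN.
  apply: eq_bigr => p _; rewrite odd_permM odd_tperm signr_addb expr1 !mulN1r.
  rewrite !mulNr; congr (- (_ * _)); rewrite /altterm.
  rewrite (bigD1 i0) // (bigD1 i1) //= [RHS](bigD1 i0) // [in RHS](bigD1 i1) //=.
  rewrite !permM tpermL tpermR !mulrA; congr (_ * _); first by rewrite /jet /=; ring.
  apply: eq_bigr => r /andP[r0 r1]; rewrite permM tpermD // eq_sym //.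
apply/eqP; rewrite -(inj_eq (@scalerI _ _ (2%:R : k) _)).
  by rewrite scaler0 scaler_nat mulr2n {1}SN addNr.
exact: (natr_neq0 char0 (n := 2)).
Qed.

Definition altfun u p : {poly k} := linext (fun j => alt (u ++ mobile j)) p.

Lemma altfun_mon u j : altfun u (mon j) = alt (u ++ mobile j).
Proof.
apply: linext_mon => s t st; apply: altsum_perm.
by rewrite perm_cat2l perm_map.
Qed.

Lemma horner_altfun u p a :
  (altfun u p).[a] =
  \sum_(m <- msupp p) p@_m * (alt (u ++ mobile (exps m))).[a].
Proof.
rewrite /altfun linextE horner_sum; apply: eq_bigr => m _.
by rewrite hornerZ.
Qed.

Lemma altfun_lin u c p q : altfun u (c *: p + q) = c *: altfun u p + altfun u q.
Proof. exact: linext_lin. Qed.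

Lemma altfun0 u : altfun u 0 = 0.
Proof. exact: linext0. Qed.

Lemma altfunD u p q : altfun u (p + q) = altfun u p + altfun u q.
Proof. by have := altfun_lin u 1 p q; rewrite !scale1r. Qed.

Lemma altfunZ u c p : altfun u (c *: p) = c *: altfun u p.
Proof. by have := altfun_lin u c p 0; rewrite addr0 altfun0 addr0. Qed.

Lemma altfun_sum u (T : Type) (r : seq T) (F : T -> dpoly k) :
  altfun u (\sum_(i <- r) F i) = \sum_(i <- r) altfun u (F i).
Proof. exact: (big_morph (altfun u) (altfunD u) (altfun0 u)). Qed.

Lemma altfun_der i p : altfun (frozen i) (d p) = (altfun (frozen i) p)^`().
Proof.
case: d_der => d_lin dM d_x.
elim/dpoly_ind: p => [|c p q IHp IHq|j].
- by rewrite (der0 d_lin) altfun0 -polyC0 derivC.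
- by rewrite d_lin !altfun_lin derivD derivZ IHp IHq.
rewrite (der_mon dM d_x) altfun_sum altfun_mon deriv_altsum succ_mobile_cat big_map.
by apply: eq_bigr => t _; rewrite altfun_mon.
Qed.

Lemma altfun_iter_der i n p :
  altfun (frozen i) (iter n d p) = (altfun (frozen i) p)^`(n).
Proof. by elim: n => //= n IHn; rewrite altfun_der IHn. Qed.

Lemma altfun_x2ideal p : x2ideal d p -> altfun [::] p = 0.
Proof.
case: (d_der) => d_lin dM d_x.
(* Quantifying over all multiples makes [S] a differential ideal: r q' = (r q)' - r' q, and the
   functional commutes with derivation. *)
pose S q := kplus q /\ forall r, altfun [::] (r * q) = 0.
move=> /(_ S) []; last by move=> _ /(_ 1); rewrite mul1r.
  split=> [q []//||p1 q [p0 Sp] [q0 Sq]|c q [q0 Sq]|r q _ [q0 Sq]|q [q0 Sq]].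
  - by split=> [|r]; rewrite ?mulr0 ?altfun0 //; exact: kplus0.
  - split=> [|r]; first exact: kplusD.
    rewrite mulrDr; apply: (etrans (altfunD _ _ _)).
    by apply: (etrans (congr2 +%R (Sp r) (Sq r))); rewrite addr0.
  - split=> [|r]; first exact: kplusZ.
    rewrite -scalerAr; apply: (etrans (altfunZ _ _ _)).
    by apply: (etrans (congr1 _ (Sq r))); rewrite scaler0.
  - split=> [|r']; first exact: kplus_mull.
    by rewrite mulrA; apply: Sq.
  split=> [|r]; first exact: kplus_der.
  have := altfun_der [::] (r * q).
  rewrite dM => E1; move: (etrans (esym (altfunD _ _ _)) E1) => {E1}.
  rewrite [X in X + _]Sq add0r => E1; apply: (etrans E1).
  by apply: (etrans (congr1 _ (Sq r))); rewrite derivC.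
split; first by apply: kplus_mulr; exact: const_term_xvar.
elim/dpoly_ind => [|c r r' IHr IHr'|j].
- by rewrite mul0r altfun0.
- rewrite (mulrDl (c *: r) r') -(scalerAl c r); apply: (etrans (altfun_lin _ _ _ _)).
  by apply: (etrans (congr2 (fun a b => c *: a + b) IHr IHr')); rewrite scaler0 addr0.
have -> : mon j * xvar k 0 ^+ 2 = mon [:: 0%N, 0%N & j].
  by rewrite !mon_cons expr2 mulrC mulrA.
by rewrite altfun_mon altsum_x2.
Qed.

(** Freezing a slot changes the polynomial but not its value at 0. *)
Lemma horner_altsum i j :
  (alt (frozen i ++ mobile j)).[0] = (alt (mobile (i ++ j))).[0].
Proof.
rewrite /altsum /mobile /frozen map_cat !size_cat !size_map -size_cat.
case: eqP => // szij; rewrite !horner_sum; apply: eq_bigr => p _.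
rewrite !horner_sum; apply: eq_bigr => q _; rewrite !hornerM; congr (_ * _).
rewrite /altterm !horner_prod; apply: eq_bigr => r _.
rewrite !nth_cat !size_map; case: ltnP => ri.
  by rewrite !(nth_map 0%N) //= /jet /= hornerC.
by [].
Qed.

Lemma altfun_mon_mul i q :
  (altfun (frozen i) q).[0] = (altfun [::] (mon i * q)).[0].
Proof.
elim/dpoly_ind: q => [|c p q IHp IHq|j].
- by rewrite mulr0 !altfun0.
- rewrite (mulrDr (mon i) (c *: p)) -(scalerAr c (mon i) p).
  rewrite altfun_lin (altfun_lin _ c (mon i * p)) !hornerD !hornerZ.
  exact: (congr2 (fun a b => c * a + b) IHp IHq).
by rewrite -mon_cat !altfun_mon horner_altsum.
Qed.

Lemma altfun_expand u p q :
  altfun u (p * q) = \sum_(m <- msupp p) p@_m *: altfun u (mon (exps m) * q).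
Proof.
transitivity (altfun u ((\sum_(m <- msupp p) p@_m *: mon (exps m)) * q)).
  by congr (altfun u (_ * q)); exact: dpolyE.
rewrite mulr_suml altfun_sum; apply: eq_bigr => m _.
by rewrite -scalerAl; exact: altfunZ.
Qed.

(** The n-th derivative of the left side falls on q alone, so its value at 0 is that of the
    functional at [p * iter n d q], which is zero. In characteristic zero the whole polynomial
    vanishes, so it may be evaluated at a second point. *)
Lemma two_point_vanish p q : (forall n, x2ideal d (p * iter n d q)) ->
  \sum_(m <- msupp p) p@_m *: altfun (frozen (exps m)) q = 0.
Proof.
move=> pq0; set P := (X in X = 0).
have P0 n : P^`(n).[0] = 0.
  have -> : P^`(n).[0] = (altfun [::] (p * iter n d q)).[0].
    rewrite altfun_expand (big_morph (derivn n) (derivnD n) (raddf0 _)) !horner_sum.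
    apply: eq_bigr => m _; rewrite derivnZ !hornerZ -altfun_iter_der.
    by apply: (congr1 (fun a => p@_m * a)); exact: altfun_mon_mul.
  by rewrite (altfun_x2ideal (pq0 n)) horner0.
apply/polyP => n; rewrite coef0.
have := P0 n; rewrite horner_coef0 coef_derivn addn0 ffactnn.
move=> /eqP; rewrite -mulr_natr mulf_eq0 => /orP[/eqP//|].
by rewrite (negbTE (natr_neq0 char0 (fact_gt0 n))).
Qed.

End Functional.

(** * Rearrangement *)

Section Rearrangement.
Local Open Scope nat_scope.

(** An increasing permutation satisfies i <= p i for all i, and so does its inverse. *)
Lemma perm_homo_id N (p : 'S_N) :
  (forall i j : 'I_N, i < j -> p i < p j) -> p = 1%g.
Proof.
have ge_id (q : 'S_N) : (forall i j : 'I_N, i < j -> q i < q j) ->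
    forall i : 'I_N, i <= q i.
  move=> qm [i]; elim: i => //= i IHi lti.
  by apply: leq_ltn_trans (IHi (ltnW lti)) _; apply: qm.
move=> pm; apply/permP => i; rewrite perm1; apply/val_inj/anti_leq => /=.
rewrite (ge_id p pm) andbT -{2}(permK p i); apply: ge_id => {}i j ij.
rewrite ltnNge leq_eqVlt; apply/negP => /orP[/eqP/val_inj/perm_inj ij'|/pm].
  by rewrite ij' ltnn in ij.
by rewrite !permKV ltnNge ltnW.
Qed.

(** Swapping an inverted pair strictly increases the sum, so a maximizer has no inversion and is the
    identity; [p] reaches the same maximum. *)
Lemma rearrangement N (S : 'I_N -> nat) (p : 'S_N) :
  (forall i j : 'I_N, i < j -> S i < S j) ->
  \sum_i S i * i <= \sum_i S i * p i -> p = 1%g.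
Proof.
move=> Sm; pose V (q : 'S_N) := \sum_i S i * q i.
have max_id (q : 'S_N) : (forall q', V q' <= V q) -> q = 1%g.
  move=> qmax; apply: perm_homo_id => i j ij; rewrite ltnNge leq_eqVlt.
  apply/negP => /orP[/eqP/val_inj/perm_inj ij'|qji].
    by rewrite ij' ltnn in ij.
  have := qmax (tperm i j * q)%g; rewrite leqNgt => /negP; apply.
  have ji : j != i by apply: contraTneq ij => ->; rewrite ltnn.
  rewrite /V (bigD1 i) // (bigD1 j) //= [X in _ < X](bigD1 i) // [X in _ < _ + X](bigD1 j) //=.
  rewrite !permM tpermL tpermR !addnA.
  rewrite [X in _ < _ + X](eq_bigr (fun l => S l * q l)) => [|l /andP[li lj]]; last first.
    by rewrite permM tpermD // eq_sym.
  rewrite ltn_add2r; have := Sm i j ij.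
  by move: (S i) (S j) (q i : nat) (q j : nat) qji => a b c e; nia.
move=> Vp; pose q := [arg max_(q > 1%g : 'S_N) V q].
have qmax q' : V q' <= V q by rewrite /q; case: arg_maxnP => // r _; apply.
have q1 := max_id q qmax.
apply: max_id => q'; apply: leq_trans (qmax q') _; rewrite q1.
by apply: leq_trans Vp; apply: leq_sum => i _; rewrite perm1.
Qed.

End Rearrangement.

Section LeadingTerm.
Local Open Scope nat_scope.
Variables (n N : nat) (S S0 : 'I_N -> nat) (p q : 'S_N).

(** Position within a block: the first n slots form one block, the remaining ones another. *)
Definition offset (r : nat) := if r < n then r else r - n.

Hypothesis S_gap : forall i j : 'I_N,
  i <= j -> (i < n) = (j < n) -> S i + 2 * (j - i) <= S j.
Hypothesis S0_gap : forall i j : 'I_N,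
  i <= j -> (i < n) = (j < n) -> S0 i + 2 * (j - i) <= S0 j.
Hypothesis S_offset : forall i : 'I_N, offset i <= S i.
Hypothesis S0_offset : forall i : 'I_N, offset i <= S0 i.
Hypothesis p_block : forall i : 'I_N, (p i < n) = (i < n).
Hypothesis q_block : forall i : 'I_N, (q i < n) = (i < n).
Hypothesis S_eq : forall i, S i = offset (p i) + (S0 (q i) - offset (q i)).
Hypothesis S_norm :
  \sum_i (S0 i - offset i) ^ 2 <= \sum_i (S i - offset i) ^ 2.

(** Expanding the squares in [S_norm] with the help of [S_eq] gives [Soff], and rearrangement forces
    p = 1. Then [S_eq] makes q match S - offset with S0 - offset; both increase strictly within
    blocks because the gaps are at least 2, so q is increasing. *)
Lemma leading_term_perms : p = 1%g /\ q = 1%g.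
Proof.
have Soff : \sum_i S i * offset i <= \sum_i S i * offset (p i).
  have sq1 : \sum_i (S i - offset i) ^ 2 + 2 * \sum_i S i * offset i =
      \sum_i S i ^ 2 + \sum_(i < N) offset i ^ 2.
    rewrite big_distrr -!big_split /=; apply: eq_bigr => i _.
    have := S_offset i; move: (S i) (offset i) => a b; nia.
  have sq2 : \sum_i (S0 i - offset i) ^ 2 + 2 * \sum_i S i * offset (p i) =
      \sum_i S i ^ 2 + \sum_(i < N) offset i ^ 2.
    rewrite (reindex_perm q) [\sum_(i < N) offset i ^ 2](reindex_perm p) /=.
    rewrite big_distrr -!big_split /=; apply: eq_bigr => i _.
    rewrite S_eq; move: (S0 (q i) - offset (q i)) (offset (p i)) => a b; nia.
  lia.
have p1 : p = 1%g.
  (* Adding [C * b i] lifts the second block above the first, so the weights increase throughout;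
     for block-preserving permutations the extra contribution is constant. *)
  pose C := (\sum_i S i).+1; pose b (i : nat) : nat := n <= i.
  have SC i : S i < C by rewrite /C ltnS (bigD1 i) //= leq_addr.
  apply: (@rearrangement _ (fun i => S i + C * b i)) => [i j ij|].
    have := S_gap (ltnW ij); have := SC i; rewrite /b; move: (S i) (S j) (C) => x y c.
    by case: (leqP n i); case: (leqP n j) => nj ni; lia.
  have split_sum (u : 'S_N) : (forall i, (u i < n) = (i < n)) ->
      \sum_(i < N) (S i + C * b i) * u i =
      \sum_(i < N) S i * offset (u i) + (\sum_(i < N) b i * n * S i + \sum_(i < N) C * b i * i).
    move=> u_block; rewrite [\sum_(i < N) C * b i * i](reindex_perm u) /=.
    rewrite -!big_split /=; apply: eq_bigr => i _.
    have -> : b (u i) = b i by rewrite /b leqNgt u_block -leqNgt.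
    have ui : u i = offset (u i) + n * b i :> nat.
      have := u_block i; rewrite /b /offset.
      by case: (ltnP (u i) n); case: (ltnP i n) => //=; lia.
    rewrite mulnDl {1}ui mulnDr -addnA; congr (_ + (_ + _)).
    by rewrite mulnC [b i * n]mulnC.
  have := split_sum 1%g; rewrite (split_sum p) //.
  rewrite (eq_bigr (fun i : 'I_N => (S i + C * b i) * i)) => [|i _]; last by rewrite perm1.
  move=> -> => [|i]; last by rewrite perm1.
  rewrite leq_add2r; apply: leq_trans Soff.
  by apply: leq_sum => i _; rewrite perm1.
split=> //; apply: perm_homo_id => i j ij.
have := q_block i; have := q_block j.
have := S_eq i; have := S_eq j; rewrite p1 !perm1.
have := S_offset i; have := S_offset j; have := S_gap (ltnW ij).
have := S0_offset (q i); have := S0_offset (q j).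
have [|qji] := ltnP (q i) (q j) => //.
have := S0_gap qji; rewrite /offset.
by case: (ltnP i n); case: (ltnP j n) => nj ni; case: (ltnP (q i) n); case: (ltnP (q j) n) => nqj nqi //; lia.
Qed.

End LeadingTerm.

(** * Products with derivatives *)

Section Jets.
Variables (k : fieldType) (a : k).
Implicit Types (h u : {poly k}) (K j w : nat).

Lemma jet_multiple K u j : (j < K)%N -> (u * ('X - a%:P) ^+ K)^`(j).[a] = 0.
Proof.
elim: j K u => [|j IHj] [|K] u // jK.
  by rewrite derivn0 exprS mulrCA hornerM hornerXsubC subrr mul0r.
rewrite derivSn derivM deriv_exp derivXsubC mul1r /=.
have -> : u^`() * ('X - a%:P) ^+ K.+1 + u * (('X - a%:P) ^+ K *+ K.+1) =
    (u^`() * ('X - a%:P) + u *+ K.+1) * ('X - a%:P) ^+ K.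
  by rewrite [RHS]mulrDl exprS mulrA mulrnAl mulrnAr.
exact: IHj.
Qed.

Lemma jet_power w j : (('X - a%:P) ^+ w)^`(j).[a] = j`!%:R *+ (j == w).
Proof.
elim: j w => [|j IHj] [|w].
- by rewrite derivn0 expr0 hornerC.
- by rewrite derivn0 exprS hornerM hornerXsubC subrr mul0r.
- by rewrite derivSn expr0 derivC derivn_poly0 ?size_poly0 // horner0.
rewrite derivSn deriv_exp derivXsubC mul1r /= derivnMn hornerMn IHj eqSS factS.
by case: eqP => [->|]; rewrite ?mul0rn // natrM mulr_natl.
Qed.

Lemma jet_congr K h u w j : (j < K)%N -> h = ('X - a%:P) ^+ w + u * ('X - a%:P) ^+ K ->
  h^`(j).[a] = j`!%:R *+ (j == w).
Proof. by move=> jK ->; rewrite derivnD hornerD jet_power jet_multiple // addr0. Qed.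

End Jets.

Lemma lex_argmin (T : eqType) (a b : T -> nat) (s : seq T) : s != [::] ->
  exists2 x, x \in s &
    forall y, y \in s -> (a x < a y)%N \/ a x = a y /\ (b x <= b y)%N.
Proof.
elim: s => // z s IHs _; have [->|/IHs[x xs xmin]] := eqVneq s [::].
  by exists z => [|y]; rewrite inE // => /eqP ->; right.
have [zx|] := boolP ((a z < a x) || (a z == a x) && (b z <= b x))%N.
  exists z => [|y]; first by rewrite inE eqxx.
  by rewrite inE => /orP[/eqP ->|/xmin]; [right|lia].
move=> zx; exists x => [|y]; first by rewrite inE xs orbT.
by rewrite inE => /orP[/eqP ->|/xmin //]; lia.
Qed.

Lemma spaced_gap s i j : spaced s -> (i <= j)%N -> (j < size s)%N ->
  (nth 0 s i + 2 * (j - i) <= nth 0 s j)%N.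
Proof.
move=> ns; elim: j => [|j IHj]; first by rewrite leqn0 => /eqP ->; rewrite addn0.
rewrite leq_eqVlt => /orP[/eqP ->|ij js]; first by rewrite subnn addn0.
have := IHj ij (ltnW js); have := (sortedP 0%N ns) j js.
by rewrite /gap2; lia.
Qed.

Lemma spaced_ge s i : spaced s -> (i < size s)%N -> (i <= nth 0 s i)%N.
Proof. by move=> ns si; have := spaced_gap ns (leq0n i) si; lia. Qed.

(** Removing the staircase 0, 1, 2, ... leaves the exponents given to the g's; their square norm
    breaks ties between monomials of equal degree. *)
Definition spread s := (\sum_(i < size s) (nth 0 s i - i) ^ 2)%N.

Lemma spread_cat s t :
  (\sum_(i < size s + size t) (nth 0 (s ++ t) i - offset (size s) i) ^ 2 =
  spread s + spread t)%N.
Proof.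
rewrite big_split_ord /=; congr (_ + _)%N; apply: eq_bigr => i _; rewrite nth_cat /offset.
  by rewrite ltn_ord.
by rewrite ltnNge leq_addr /= addKn.
Qed.

Section CatNormal.
Variables s t : seq nat.
Hypotheses (ns : spaced s) (nt : spaced t).

Lemma cat_spaced_gap i j : (j < size s + size t)%N ->
  (i <= j)%N -> (i < size s)%N = (j < size s)%N ->
  (nth 0 (s ++ t) i + 2 * (j - i) <= nth 0 (s ++ t) j)%N.
Proof.
move=> ltj ij; rewrite !nth_cat.
case: (ltnP i (size s)); case: (ltnP j (size s)) => // sj si _.
  exact: spaced_gap.
have := @spaced_gap t (i - size s) (j - size s) nt; lia.
Qed.

Lemma cat_spaced_offset i : (i < size s + size t)%N ->
  (offset (size s) i <= nth 0 (s ++ t) i)%N.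
Proof.
rewrite nth_cat /offset => lti.
by case: (ltnP i (size s)) => si; [exact: spaced_ge|apply: spaced_ge => //; lia].
Qed.

End CatNormal.

(** * Polynomials concentrated at the points 0 and 1 *)

Section TwoPoint.
Variables (k : fieldType) (s0 t0 : seq nat) (K : nat).
Local Notation n := (size s0).
Local Notation N := (size s0 + size t0)%N.

(* [bump0] is 1 to order [K] at [0] and vanishes to order [K] at [1]. *)
Definition bump0 : {poly k} := (1 - 'X ^+ K) ^+ K.

(** To order [K]: for r in the first block, X^c at 0 and zero at 1; for r in the second, zero at 0
    and (X - 1)^c at 1. *)
Definition local_power (r c : nat) : {poly k} :=
  if (r < n)%N then bump0 * 'X ^+ c else (1 - bump0) * ('X - 1) ^+ c.

(** The exponents of [fpow r] and [gpow r] add up to entry r of [s0 ++ t0] when both sequences are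
    spaced, so the term p = q = 1 detects that sequence. *)
Definition fpow (r : 'I_N) := local_power r (offset n r).
Definition gpow (r : 'I_N) := local_power r (nth 0 (s0 ++ t0) r - offset n r).

Lemma bump0_at0 : exists u, bump0 = 1 + u * 'X ^+ K.
Proof.
exists (- \sum_(i < K) (1 - 'X^K) ^+ i).
have E : bump0 = 1 + (1 - 'X^K - 1) * \sum_(i < K) (1 - 'X^K) ^+ i.
  by rewrite -subrX1 addrC subrK.
by rewrite E addrAC subrr add0r !mulNr mulrC.
Qed.

Lemma bump0_at1 : exists u, bump0 = u * ('X - 1) ^+ K.
Proof.
exists ((- \sum_(i < K) 'X ^+ i) ^+ K).
by rewrite -exprMn mulNr mulrC -subrX1 opprB.
Qed.

(** The value [true] of [b] stands for the point 0 and the first block, [false] for the point 1 and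
    the second block. *)
Lemma local_powerE (b : bool) r c (Y := 'X - ((~~ b)%:R : k)%:P) :
  exists v, local_power r c = Y ^+ c *+ ((r < n)%N == b) + v * Y ^+ K.
Proof.
rewrite /Y /local_power; case: bump0_at0 => u0 E0; case: bump0_at1 => u1 E1.
case: b Y => /= Y; case: (r < n)%N; rewrite /= ?mulr1n ?mulr0n ?polyC0 ?polyC1 ?subr0 ?add0r.
- by exists (u0 * 'X^c); rewrite E0; ring.
- by exists (- u0 * ('X - 1) ^+ c); rewrite E0; ring.
- by exists (u1 * 'X^c); rewrite E1; ring.
by exists (- u1 * ('X - 1) ^+ c); rewrite E1; ring.
Qed.

Lemma two_point_jet (b : bool) r1 r2 c1 c2 j : (j < K)%N ->
  (local_power r1 c1 * local_power r2 c2)^`(j).[(~~ b)%:R] =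
  j`!%:R *+ [&& (r1 < n)%N == b, (r2 < n)%N == b & j == (c1 + c2)%N].
Proof.
move=> jK; have [v1 ->] := local_powerE b r1 c1; have [v2 ->] := local_powerE b r2 c2.
set a := (~~ b)%:R; set Y := 'X - a%:P.
case: (_ == b) => /=; last first.
  rewrite !mulr0n add0r mulrAC; exact: jet_multiple.
case: (_ == b) => /=; last first.
  rewrite !mulr0n add0r mulrA; exact: jet_multiple.
rewrite !mulr1n; apply: (@jet_congr _ _ K _ (Y ^+ c1 * v2 + v1 * Y ^+ c2 + v1 * v2 * Y ^+ K)) => //.
by rewrite exprD; ring.
Qed.

(** A nonzero term needs p and q to preserve the blocks and the exponents to match in every slot,
    which [leading_term_perms] allows only for p = q = 1; that term is nonzero exactly when the
    sequences agree. *)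
Lemma altsum_two_point s t : spaced s0 -> spaced t0 -> spaced s -> spaced t ->
  (n < size s)%N \/ n = size s /\ (spread s0 <= spread s)%N ->
  (size t0 < size t)%N \/ size t0 = size t /\ (spread t0 <= spread t)%N ->
  (forall j, j \in s ++ t -> (j < K)%N) ->
  (altsum fpow gpow (frozen s ++ mobile t)).[1] =
  (\prod_(j <- s0 ++ t0) j`!%:R) *+ (s ++ t == s0 ++ t0).
Proof.
move=> ns0 nt0 ns nt s0s t0t jK; rewrite /altsum size_cat !size_map.
case: eqP => szst; last first.
  by rewrite horner0; case: eqP => // /(congr1 size); rewrite !size_cat.
(* Neither size is below its counterpart and the totals agree, so both sizes agree. *)
have ss : size s = n by lia.
have st : size t = size t0 by lia.
have {s0s t0t} le_spread : (spread s0 + spread t0 <= spread s + spread t)%N by lia.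
pose S (r : 'I_N) := nth 0%N (s ++ t) r; pose S0 (r : 'I_N) := nth 0%N (s0 ++ t0) r.
have termE (p q : 'S_N) : (altterm fpow gpow p q (frozen s ++ mobile t)).[1] =
    \prod_r ((S r)`!%:R *+ [&& (p r < n)%N == (r < n)%N, (q r < n)%N == (r < n)%N &
      S r == (offset n (p r) + (S0 (q r) - offset n (q r)))%N]).
  rewrite /altterm horner_prod; apply: eq_bigr => r _; rewrite -two_point_jet; last first.
    by apply: jK; rewrite mem_nth // size_cat ss st.
  rewrite /S !nth_cat size_map ss; case: (ltnP r n) => rn /=.
    by rewrite (nth_map 0%N) ?ss //= /jet /= hornerC.
  by rewrite (nth_map 0%N) ?st //= ltn_subLR.
have term0 (p q : 'S_N) : (p, q) != (1%g, 1%g) ->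
    (altterm fpow gpow p q (frozen s ++ mobile t)).[1] = 0.
  move=> pq1; apply/eqP; rewrite termE; apply: contraNT pq1 => /prodf_neq0 nz.
  have {}nz r : [/\ (p r < n)%N = (r < n)%N, (q r < n)%N = (r < n)%N &
      S r = (offset n (p r) + (S0 (q r) - offset n (q r)))%N].
    by have := nz r isT; case: and3P => [[/eqP ? /eqP ? /eqP ?]|]; rewrite ?eqxx.
  have [||||||||-> ->] // := @leading_term_perms n N S S0 p q.
  - move=> i j; have ltj : (j < size s + size t)%N by rewrite ss st.
    by have := cat_spaced_gap ns nt ltj (i := i); rewrite ss.
  - by move=> i j; apply: cat_spaced_gap.
  - move=> i; have lti : (i < size s + size t)%N by rewrite ss st.
    by have := cat_spaced_offset ns nt lti; rewrite ss.
  - by move=> i; apply: cat_spaced_offset.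
  - by move=> r; case: (nz r).
  - by move=> r; case: (nz r).
  - by move=> r; case: (nz r).
  have := spread_cat s t; rewrite ss st /S => ->.
  by rewrite /S0 spread_cat.
rewrite horner_sum (bigD1 1%g) //= horner_sum (bigD1 1%g) //=.
rewrite [X in _ + X + _]big1 ?addr0; last first.
  move=> q q1; rewrite hornerM term0 ?mulr0 //; apply: contraNneq q1 => -[->]; exact: eqxx.
rewrite big1 ?addr0; last first.
  move=> p p1; rewrite horner_sum big1 // => q _; rewrite hornerM term0 ?mulr0 //.
  by apply: contraNneq p1 => -[-> _].
rewrite odd_perm1 expr0 !mul1r termE.
have [E|nE] := eqVneq (s ++ t) (s0 ++ t0).
  rewrite mulr1n -E (big_nth 0%N) big_mkord size_cat ss st; apply: eq_bigr => r _.
  rewrite !perm1 !eqxx /= subnKC /S0 -E ?eqxx ?mulr1n //.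
  by rewrite E; apply: cat_spaced_offset.
rewrite mulr0n; apply/eqP; apply: contraNT nE => /prodf_neq0 nz; apply/eqP.
apply: (@eq_from_nth _ 0%N) => [|i]; first by rewrite !size_cat ss st.
rewrite size_cat ss st => iN; have := nz (Ordinal iN) isT; rewrite !perm1 !eqxx /=.
rewrite subnKC; last exact: cat_spaced_offset.
by case: (eqVneq (S _) (S0 _)) => [E _|_]; [exact: E|rewrite mulr0n eqxx].
Qed.

End TwoPoint.

(** * Products P Q^(n) of spaced polynomials *)

Section DifferentialProduct.
Variables (k : fieldType) (d : dpoly k -> dpoly k).
Hypothesis d_der : is_kx_derivation d.
Hypothesis char0 : [pchar k] =i pred0.

(** The leading monomial has least degree and then least [spread], the order in which
    [altsum_two_point] isolates it. *)
Lemma poly_leading (p : dpoly k) : p != 0 -> exists2 m, m \in msupp p &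
  forall m', m' \in msupp p -> (size (exps m) < size (exps m'))%N \/
    size (exps m) = size (exps m') /\ (spread (exps m) <= spread (exps m'))%N.
Proof.
move=> p0; apply: lex_argmin; apply: contraNneq p0 => p0.
by rewrite -msupp_eq0; apply/eqP/fsetP => m; rewrite in_fset0 -[RHS](in_nil m) -p0.
Qed.

(** With f and g built from the leading monomials, the value at 1 in [two_point_vanish] is the
    product of the two leading coefficients and of factorials, which is nonzero. *)
Lemma spaced_product (p q : dpoly k) : p != 0 -> q != 0 ->
  spaced_poly p -> spaced_poly q -> ~ (forall n, x2ideal d (p * iter n d q)).
Proof.
move=> /poly_leading[m0 m0p m0min] /poly_leading[m1 m1q m1min] np nq pq0.
(* [K] exceeds every index in p and q, so no derivative taken reaches the order of the error
   terms. *)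
pose K := (\sum_(m <- msupp p) sumn (exps m) + \sum_(m <- msupp q) sumn (exps m)).+1%N.
have ltK m m' j : m \in msupp p -> m' \in msupp q ->
    j \in exps m ++ exps m' -> (j < K)%N.
  move=> mp mq; have le_sumn (s : seq nat) : j \in s -> (j <= sumn s)%N.
    by move=> js; rewrite sumnE (big_rem j) //= leq_addr.
  rewrite mem_cat ltnS => /orP[/le_sumn|/le_sumn] /leq_trans; apply.
    by rewrite (big_fsetD1 m mp) /= -addnA leq_addr.
  by rewrite (big_fsetD1 m' mq) /= addnCA leq_addr.
pose f := fpow k (s0 := exps m0) (t0 := exps m1) K.
pose g := gpow k (s0 := exps m0) (t0 := exps m1) K.
pose C : k := \prod_(j <- exps m0 ++ exps m1) j`!%:R.
have altE m m' : m \in msupp p -> m' \in msupp q ->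
    (altsum f g (frozen (exps m) ++ mobile (exps m'))).[1] =
    C *+ ((m == m0) && (m' == m1)).
  move=> mp mq; have [m_min m'_min] := (m0min _ mp, m1min _ mq).
  rewrite altsum_two_point //; try by [exact: np|exact: nq|move=> j; exact: ltK].
  congr (_ *+ nat_of_bool _); apply/eqP/andP => [E|[/eqP -> /eqP ->] //].
  (* Equal concatenations may be cut at different places; minimality of both degrees rules this
     out. *)
  have szE : size (exps m) = size (exps m0).
    have := congr1 size E; rewrite !size_cat.
    case: m_min m'_min => [l1|[l1 _]] [l2|[l2 _]]; move: l1 l2;
      move: (size (exps m)) (size (exps m')) (size (exps m0)) (size (exps m1)) => a1 a2 a3 a4; lia.
  by move/eqP: E; rewrite eqseq_cat // => /andP[/eqP/exps_inj -> /eqP/exps_inj ->].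
have := two_point_vanish d_der char0 f g pq0.
move=> /(congr1 (fun P => P.[1])); rewrite horner0 horner_sum (big_fsetD1 m0) //=.
rewrite [X in _ + X]big1_fset ?addr0 => [|m]; last first.
  rewrite in_fsetD1 => /andP[/negbTE mm0 mp] _; rewrite hornerZ horner_altfun.
  rewrite big1_fset ?mulr0 // => m' m'q _.
  by rewrite altE // mm0 mulr0n mulr0.
rewrite hornerZ horner_altfun (big_fsetD1 m1) //= altE // !eqxx mulr1n.
rewrite big1_fset ?addr0 => [|m']; last first.
  by rewrite in_fsetD1 => /andP[/negbTE mm1 mq] _; rewrite altE // mm1 andbF mulr0n mulr0.
apply/eqP; rewrite !mulf_neq0 ?mcoeff_neq0 //.
rewrite prodf_seq_neq0; apply/allP => j _; apply/implyP => _.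
by apply: natr_neq0 => //; apply: fact_gt0.
Qed.

End DifferentialProduct.

(** * Differential operators *)

Section FiniteDifference.
Variables (V : zmodType) (I : V -> Prop).
Hypothesis I_sub : forall p q, I p -> I q -> I (p - q).

(** By Pascal's rule, the difference between r + 1 and r lowers each l by one and kills the terms
    with l = 0; after L differences only the terms with l = L remain. *)
Lemma binomial_leading L (T : Type) (s : seq T) (P : pred T) (u l : T -> nat) (v : T -> V) :
  (forall t, P t -> (l t <= L)%N) ->
  (forall r, I (\sum_(t <- s | P t) v t *+ 'C(u t + r, l t))) ->
  I (\sum_(t <- s | P t && (l t == L)) v t).
Proof.
elim: L l P => [|L IHL] l P lL Ir.
  have := Ir 0%N; congr I; rewrite [LHS](eq_bigl (fun t => P t && (l t == 0%N))).
    by apply: eq_bigr => t /andP[_ /eqP ->]; rewrite bin0.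
  by move=> t; case Pt: (P t) => //=; have := lL t Pt; rewrite leqn0 => ->.
have := IHL (fun t => (l t).-1) (fun t => P t && (0 < l t)%N).
have -> : \sum_(t <- s | (P t && (0 < l t)%N) && ((l t).-1 == L)) v t =
    \sum_(t <- s | P t && (l t == L.+1)) v t.
  by apply: eq_bigl => t; rewrite -andbA; congr (_ && _); case: (l t).
apply=> [t /andP[/lL]|r]; first by case: (l t).
have := I_sub (Ir r.+1) (Ir r); rewrite -sumrB (bigID (fun t => 0 < l t)%N) /=.
rewrite [X in _ + X]big1 ?addr0 => [|t /andP[_]]; last first.
  by rewrite lt0n negbK => /eqP ->; rewrite !bin0 subrr.
congr I; apply: eq_bigr => t /andP[_ lt0].
by rewrite addnS -{1}(prednK lt0) binS mulrnDr prednK // addrAC subrr add0r.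
Qed.

End FiniteDifference.

Lemma sum_binomial_index (V : nmodType) i j M (F : nat -> V) :
  \sum_(l < i.+1 | (i + j - l)%N == M) F l *+ 'C(i, l) =
  if (M <= i + j)%N then F (i + j - M)%N *+ 'C(i, i + j - M) else 0.
Proof.
case: leqP => Mij; last by rewrite big1 // => l /eqP; lia.
have [lt_l|ge_l] := ltnP (i + j - M) i.+1.
  rewrite (big_pred1 (Ordinal lt_l)) // => l; apply/eqP/eqP => [E|->] /=.
    by apply: val_inj => /=; have := ltn_ord l; lia.
  by lia.
rewrite bin_small ?mulr0n // big1 // => l /eqP; have := ltn_ord l; lia.
Qed.

Lemma mul_sub_split (A : comNzRingType) (p p' y y' : A) :
  p' * y' = p * y - (y * (p - p') + p' * (y - y')).
Proof. by ring. Qed.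

Section Operators.
Variables (k : fieldType) (d : dpoly k -> dpoly k).
Hypothesis d_der : is_kx_derivation d.
Hypothesis char0 : [pchar k] =i pred0.
Local Notation I := (x2ideal d).
Implicit Types (p q : dpoly k) (a b : seq (dpoly k)).

Let d_lin : forall (c : k) (p q : dpoly k), d (c *: p + q) = c *: d p + d q.
Proof. by case: d_der. Qed.

Lemma iter_der0 n : iter n d 0 = 0.
Proof. by elim: n => //= n ->; exact: der0 d_lin. Qed.

(** Otherwise all derivatives of x would lie in I, against [spaced_product] for 1 and x. *)
Lemma x2ideal_xvar0 : ~ I (xvar k 0).
Proof.
move=> Ix; apply: (@spaced_product _ d d_der char0 (mon (xvar k) [::]) (mon (xvar k) [:: 0%N])).
- by rewrite monE monalgU_eq0 oner_eq0.
- by rewrite monE monalgU_eq0 oner_eq0.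
- exact: spaced_poly_mon.
- exact: spaced_poly_mon.
move=> n; apply: x2idealM => //; apply: x2ideal_der => //.
by rewrite mon_cons mon_nil mulr1.
Qed.

(** The spaced normal forms of p and q are nonzero and may replace them modulo I, so
    [spaced_product] applies. *)
Lemma x2ideal_product p q : ~ I p -> ~ I q -> exists n, ~ I (p * iter n d q).
Proof.
move=> Ip Iq; apply: not_all_ex_not => Ipq.
have [p' Ipp' np] := normal_form d_der char0 p.
have [q' Iqq' nq] := normal_form d_der char0 q.
apply: (spaced_product d_der char0 _ _ np nq) => [||n].
- by apply/eqP => p0; apply: Ip; rewrite p0 subr0 in Ipp'.
- by apply/eqP => q0; apply: Iq; rewrite q0 subr0 in Iqq'.
rewrite (mul_sub_split p p' (iter n d q)) -(iter_derB d_lin).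
apply: x2idealB; [by []|exact: Ipq|apply: x2idealD; [by []| |]].
  by apply: x2idealM.
by apply: x2idealM => //; apply: x2ideal_der.
Qed.

Lemma opcoef_mul a b M : opcoef (opmul d a b) M =
  \sum_(i < size a) \sum_(j < size b)
    if (M <= i + j)%N then
      (opcoef a i * iter (i + j - M) d (opcoef b j)) *+ 'C(i, i + j - M)
    else 0.
Proof.
rewrite /opcoef /opmul; have [ltM|geM] := ltnP M (size a + size b).
  rewrite nth_mkseq //; apply: eq_bigr => i _; apply: eq_bigr => j _.
  exact: (sum_binomial_index i j M (fun l => nth 0 a i * iter l d (nth 0 b j))).
rewrite nth_default ?size_mkseq // big1 // => i _; rewrite big1 // => j _.
by case: leqP => // Mij; have := ltn_ord i; have := ltn_ord j; lia.
Qed.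

(** The order of an operator is read modulo I, since a representative may end in entries from I. *)
Lemma top_coef a : ~ op_zero d a ->
  exists2 n, ~ I (opcoef a n) & forall i, (n < i)%N -> I (opcoef a i).
Proof.
move=> a0; have [i0 ai0] : exists i, ~ I (opcoef a i).
  apply: not_all_ex_not => Ia; apply: a0 => i.
  by rewrite {2}/opcoef nth_nil subr0.
have bounded i : (size a <= i)%N -> I (opcoef a i).
  by move=> le_i; rewrite /opcoef nth_default //; apply: x2ideal0.
elim: (size a) bounded => [|N IHN] bounded; first by case: ai0; apply: bounded.
have [IN|nIN] := classic (I (opcoef a N)); last by exists N.
by apply: IHN => i; rewrite leq_eqVlt => /orP[/eqP <-|/bounded].
Qed.

(* The operator p \partial^r. *)
Definition shifted (r : nat) p : seq (dpoly k) := rcons (nseq r 0) p.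

Lemma opcoef_shifted r p j : opcoef (shifted r p) j = if j == r then p else 0.
Proof.
rewrite /opcoef /shifted nth_rcons size_nseq; case: ltngtP => // jr.
by rewrite nth_nseq jr.
Qed.

(* The coefficient of \partial^m in a p, hence of \partial^(m + r) in
   a p \partial^r. *)
Definition rightcoef a p m : dpoly k :=
  \sum_(i < size a)
    if (m <= i)%N then (opcoef a i * iter (i - m) d p) *+ 'C(i, i - m) else 0.

Lemma opcoef_mul_shifted a r p M : opcoef (opmul d a (shifted r p)) M =
  if (r <= M)%N then rightcoef a p (M - r) else 0.
Proof.
rewrite opcoef_mul size_rcons size_nseq.
transitivity (\sum_(i < size a) if (M <= i + r)%N then
    (opcoef a i * iter (i + r - M) d p) *+ 'C(i, i + r - M) else 0).
  apply: eq_bigr => i _; rewrite big_ord_recr /= opcoef_shifted eqxx.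
  rewrite big1 ?add0r // => j _; rewrite opcoef_shifted ltn_eqF //.
  by rewrite iter_der0 (mulr0 (opcoef a i)) mul0rn; case: ifP.
case: leqP => rM; last first.
  rewrite big1 // => i _; rewrite bin_small ?mulr0n; first by case: ifP.
  by have := ltn_ord i; lia.
apply: eq_bigr => i _.
have -> : ((M - r <= i) = (M <= i + r))%N by lia.
have -> : (i - (M - r) = i + r - M)%N by lia.
reflexivity.
Qed.

Lemma opcoef_mul_shifted_mul a r p b M : opcoef (opmul d (opmul d a (shifted r p)) b) M =
  \sum_(i < (size a).+1) \sum_(j < size b)
    if (M <= r + i + j)%N then
      (rightcoef a p i * iter (r + i + j - M) d (opcoef b j)) *+ 'C(r + i, r + i + j - M)
    else 0.
Proof.
rewrite opcoef_mul {1}/opmul size_mkseq size_rcons size_nseq addnS -addSn addnC.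
rewrite -(big_mkord xpredT (fun i => \sum_(j < size b)
    if (M <= i + j)%N then
      (opcoef (opmul d a (shifted r p)) i * iter (i + j - M) d (opcoef b j))
        *+ 'C(i, i + j - M) else 0)).
(* The first r coefficients of a p \partial^r are zero, so the range is cut at r and shifted. *)
rewrite (big_cat_nat (leq0n r) (leq_addr _ _)) /=.
rewrite big_nat_cond big1 ?add0r => [|i /andP[/andP[_ ir] _]]; last first.
  rewrite big1 // => j _; rewrite opcoef_mul_shifted [(r <= i)%N]leqNgt ir /=.
  by rewrite (mul0r (iter _ d (opcoef b j))) mul0rn; case: ifP.
rewrite -{1}[r]add0n big_addn addKn big_mkord; apply: eq_bigr => i _.
apply: eq_bigr => j _; rewrite opcoef_mul_shifted [(i + r)%N]addnC leq_addr addKn.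
reflexivity.
Qed.

Lemma rightcoef_x2ideal a p n m : (forall i, (n < i)%N -> I (opcoef a i)) ->
  (n < m)%N -> I (rightcoef a p m).
Proof.
move=> aI nm; apply: (x2ideal_sum d_der) => i _; case: leqP => mi; last exact: (x2ideal0 d_der).
apply: (x2idealMn d_der); apply: (x2idealMr d_der).
by apply: aI; apply: leq_trans mi.
Qed.

(** In the sum for [rightcoef a p n], every term with i > n lies in I, which leaves the
    undifferentiated term i = n. *)
Lemma rightcoef_top a p n : ~ I (opcoef a n) ->
  (forall i, (n < i)%N -> I (opcoef a i)) ->
  I (rightcoef a p n) -> I (opcoef a n * p).
Proof.
move=> an aI; have [lt_n|ge_n] := ltnP n (size a); last first.
  by case: an; rewrite /opcoef nth_default //; apply: x2ideal0.
pose F (i : 'I_(size a)) := if (n <= i)%N then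
  (opcoef a i * iter (i - n) d p) *+ 'C(i, i - n) else 0.
set q := \sum_(i | i != Ordinal lt_n) F i.
have F0 : F (Ordinal lt_n) = opcoef a n * p.
  by rewrite /F leqnn subnn bin0; exact: mulr1n.
have -> : rightcoef a p n = opcoef a n * p + q.
  by rewrite -F0; exact: bigD1.
move=> Isum; rewrite -[X in I X](addrK q); apply: (x2idealB d_der Isum).
apply: (x2ideal_sum d_der) => i ni; rewrite /F; case: leqP => mi; last exact: (x2ideal0 d_der).
apply: (x2idealMn d_der); apply: (x2idealMr d_der).
apply: aI; rewrite ltn_neqAle mi andbT eq_sym; exact: ni.
Qed.

(** In the coefficient r + n + m of the product with \partial^(L + r), the term (i, j) carries C(L +
    i + r, L + i + j - n - m). The lower index is free of r and, for i <= n and j <= m, equals L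
    only at (n, m), so [binomial_leading] isolates that term. *)
Lemma vanishing_products a b p n m :
  (forall i, (n < i)%N -> I (opcoef a i)) ->
  (forall i, (m < i)%N -> I (opcoef b i)) ->
  (n < (size a).+1)%N -> (m < size b)%N ->
  (forall r, op_zero d (opmul d (opmul d a (shifted r p)) b)) ->
  forall L, I (rightcoef a p n * iter L d (opcoef b m)).
Proof.
move=> aI bI na mb ab0 L.
pose T := ('I_(size a).+1 * 'I_(size b))%type.
(* The last condition keeps the truncated subtraction in [l] exact; the terms outside [P] are zero
   or in I. *)
pose P (t : T) := [&& (t.1 <= n)%N, (t.2 <= m)%N & (n + m <= L + t.1 + t.2)%N].
pose l (t : T) := (L + t.1 + t.2 - (n + m))%N.
pose v (t : T) : dpoly k := rightcoef a p t.1 * iter (l t) d (opcoef b t.2).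
have Pl t : P t -> (l t <= L)%N by move=> /and3P[]; rewrite /l; lia.
have lead := @binomial_leading _ I (x2idealB d_der) L T (index_enum T) P
  (fun t => L + t.1)%N l v Pl.
rewrite (big_pred1 (Ordinal na, Ordinal mb)) in lead; last first.
  move=> [i j]; rewrite /P /l /=; apply/andP/eqP => [[/and3P[? ? ?] /eqP ?]|[-> ->]].
    by congr (_, _); apply: val_inj => /=; lia.
  by split; [apply/and3P; split|apply/eqP] => /=; lia.
have -> : rightcoef a p n * iter L d (opcoef b m) = v (Ordinal na, Ordinal mb).
  by rewrite /v /l /=; have -> : (L + n + m - (n + m) = L)%N by lia.
apply: lead => r.
pose G (t : T) : dpoly k := if (r + n + m <= L + r + t.1 + t.2)%N then
  (rightcoef a p t.1 * iter (L + r + t.1 + t.2 - (r + n + m)) d (opcoef b t.2))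
    *+ 'C(L + r + t.1, L + r + t.1 + t.2 - (r + n + m)) else 0.
have IG : I (\sum_t G t).
  have := ab0 (L + r)%N (r + n + m)%N; rewrite {2}/opcoef nth_nil subr0.
  by rewrite opcoef_mul_shifted_mul pair_bigA.
have IGnP : I (\sum_(t | ~~ P t) G t).
  apply: (x2ideal_sum d_der) => -[i j]; rewrite /P /G /= => nP.
  case: leqP => le_t; last exact: (x2ideal0 d_der).
  apply: (x2idealMn d_der); have [ni|ni] := ltnP n i.
    by apply: (x2idealMr d_der); apply: rightcoef_x2ideal ni.
  apply: (x2idealM d_der); apply: (x2ideal_der d_der); apply: bI.
  by move: nP; rewrite ni /=; lia.
have -> : \sum_(t | P t) v t *+ 'C(L + t.1 + r, l t) = \sum_(t | P t) G t.
  apply: eq_bigr => -[i j] /and3P[_ _ /= le_t]; rewrite /G /v /l /=.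
  have -> : (r + n + m <= L + r + i + j)%N by lia.
  have -> : (L + r + i + j - (r + n + m) = L + i + j - (n + m))%N by lia.
  by have -> : (L + i + r = L + r + i)%N by lia.
have -> : \sum_(t | P t) G t = \sum_t G t - \sum_(t | ~~ P t) G t.
  by rewrite [\sum_t G t](bigID P) /=; symmetry; exact: addrK.
exact: (x2idealB d_der).
Qed.

End Operators.

(** * Primeness of the algebra of differential operators *)

Theorem theorem2 (k : fieldType) (d : dpoly k -> dpoly k) :
  [pchar k] =i pred0 ->
  is_kx_derivation d ->
  forall I J : seq (dpoly k) -> Prop,
    op_ideal d I -> op_ideal d J ->
    nonzero_ideal d I -> nonzero_ideal d J ->
    exists c, ideal_prod d I J c /\ ~ op_zero d c.
Proof.
move=> char0 d_der I J I_ideal J_ideal [a [Ia a0]] [b [Jb b0]].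
have [n an aI] := top_coef d_der a0.
have [m bm bI] := top_coef d_der b0.
have [w aw] : exists w, ~ x2ideal d (opcoef a n * xvar k w).
  have [w] := x2ideal_product d_der char0 an (x2ideal_xvar0 d_der char0).
  by case: d_der => _ _ d_x; rewrite (iter_der_x d_x); exists w.
set p := xvar k w in aw.
have top : ~ x2ideal d (rightcoef d a p n).
  by move=> /(rightcoef_top d_der an aI).
have [L prodL] := x2ideal_product d_der char0 top bm.
have [r cr] : exists r, ~ op_zero d (opmul d (opmul d a (shifted r p)) b).
  apply: not_all_ex_not => ab0; apply: prodL.
  apply: (vanishing_products d_der aI bI) ab0 _.
    rewrite ltnS leqNgt; apply/negP => lt_n; apply: an.
    by rewrite /opcoef nth_default ?(ltnW lt_n) //; exact: x2ideal0.
  rewrite ltnNge; apply/negP => le_m; apply: bm.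
  by rewrite /opcoef nth_default //; exact: x2ideal0.
have is_op_p : is_op (shifted r p).
  by move=> i; rewrite opcoef_shifted; case: eqP => _; [exact: const_term_xvar|exact: kplus0].
have Iap : I (opmul d a (shifted r p)) by apply: (oi_mulr I_ideal).
set c := opmul d _ b in cr.
(* This is literally the [foldr] of [ideal_prod] for a single pair. *)
pose c' := opadd c [::].
have c'E i : opcoef c' i = opcoef c i.
  rewrite /c' /opcoef /opadd /= maxn0; have [lti|gei] := ltnP i (size c).
    by rewrite nth_mkseq // /opcoef nth_nil; exact: addr0.
  by rewrite [RHS]nth_default // nth_default // size_mkseq.
exists c'; split; last first.
  by move=> c0; apply: cr => i; have := c0 i; rewrite c'E.
split; last first.
  exists [:: (opmul d a (shifted r p), b)]; split=> [u|i]; last first.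
    by rewrite /= subrr; exact: x2ideal0.
  by rewrite inE => /eqP ->.
move=> i; rewrite c'E; apply: (oi_sub I_ideal).
exact: (oi_mulr I_ideal Iap (oi_sub J_ideal Jb)).
Qed.
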